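(* Let $\mathcal{C}_3$ be the triangle graph with vertices $x,y,z$, edge weights $w_{xy}=w_{xz}=w_{yz}=1$, vertex measure $\mu(x)=\mu(y)=\mu(z)=2$, and a signature $\sigma:E^{or}\to U(1)$, and let $s=Sgn(\mathcal{C}_3)\in U(1)$ be the signature of the cycle. Then $(\mathcal{C}_3,\mu,\sigma)$ has constant $\infty$-dimensional Ricci curvature at every vertex, and its value $K_\infty(s):=K_\infty(\mathcal{C}_3,\mu,\sigma)$ is $$K_\infty(s)=\begin{cases}\dfrac54,&\text{if } s=1,\\[2mm]\dfrac{5-\sqrt{17+8\,\mathrm{Re}(s)}}{8},&\text{otherwise.}\end{cases}$$
   Context: $E^{or}$ is the set of oriented edges; a signature satisfies $\sigma_{vu}=\sigma_{uv}^{-1}$; $U(1)=\{z\in\mathbb{C}:|z|=1\}$. $Sgn(\mathcal{C}_3)=\sigma_{xy}\sigma_{yz}\sigma_{zx}$. With $V=\{x,y,z\}$, for $u:V\to\mathbb{C}$, $\Delta u(v)=\frac1{\mu(v)}\sum_{v'\sim v}w_{vv'}(u(v')-u(v))$ and $\Delta^\sigma u(v)=\frac1{\mu(v)}\sum_{v'\sim v}w_{vv'}(\sigma_{vv'}u(v')-u(v))$. For $f,g:V\to\mathbb{C}$, $2\Gamma^\sigma(f,g)=\Delta(f\overline g)-f\,\overline{\Delta^\sigma g}-(\Delta^\sigma f)\overline g$ and $2\Gamma_2^\sigma(f,g)=\Delta\Gamma^\sigma(f,g)-\Gamma^\sigma(f,\Delta^\sigma g)-\Gamma^\sigma(\Delta^\sigma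 f,g)$. The $\infty$-dimensional Ricci curvature at a vertex $v$ is the largest $K\in\mathbb{R}$ such that $\Gamma_2^\sigma(f,f)(v)\ge K\,\Gamma^\sigma(f,f)(v)$ for all $f:V\to\mathbb{C}$, and $K_\infty(\mathcal{C}_3,\mu,\sigma)$ is its minimum over all vertices. *)

(* Defs.v *)
From HB Require Import structures.
From mathcomp Require Import all_boot all_order all_algebra.
From mathcomp Require Import reals complex.

Set Implicit Arguments.
Unset Strict Implicit.
Unset Printing Implicit Defensive.
Import Order.TTheory GRing.Theory Num.Theory.
Local Open Scope ring_scope.
Local Open Scope complex_scope.

(* Values of [weight] off the edge set are irrelevant: every sum below ranges
   over neighbours only. *)
Record wgraph (R : realType) (V : finType) := WGraph {
  adj : rel V;
  weight : V -> V -> R;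
  measure : V -> R;
  adj_sym : symmetric adj;
  adj_irr : irreflexive adj;
  weight_sym : forall u v, weight u v = weight v u;
  weight_gt0 : forall u v, adj u v -> 0 < weight u v;
  measure_gt0 : forall v, 0 < measure v
}.

(* A map E^or -> U(1) is given by a function on pairs of vertices, constrained
   (and used) only on adjacent ones. *)
Definition is_signature (R : realType) (V : finType) (G : wgraph R V)
    (sigma : V -> V -> R[i]) : Prop :=
  forall u v, adj G u v ->
    `|sigma u v| = 1 /\ sigma v u = (sigma u v)^-1.

Definition lap (R : realType) (V : finType) (G : wgraph R V)
    (u : V -> R[i]) (v : V) : R[i] :=
  (measure G v)^-1%:C *
    \sum_(v' | adj G v v') (weight G v v')%:C * (u v' - u v).

Definition slap (R : realType) (V : finType) (G : wgraph R V)
    (sigma : V -> V -> R[i]) (u : V -> R[i]) (v : V) : R[i] :=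
  (measure G v)^-1%:C *
    \sum_(v' | adj G v v') (weight G v v')%:C * (sigma v v' * u v' - u v).

Definition Gam (R : realType) (V : finType) (G : wgraph R V)
    (sigma : V -> V -> R[i]) (f g : V -> R[i]) (v : V) : R[i] :=
  (lap G (fun a => f a * (g a)^*) v
   - f v * (slap G sigma g v)^*
   - slap G sigma f v * (g v)^*) / 2%:R.

Definition Gam2 (R : realType) (V : finType) (G : wgraph R V)
    (sigma : V -> V -> R[i]) (f g : V -> R[i]) (v : V) : R[i] :=
  (lap G (Gam G sigma f g) v
   - Gam G sigma f (slap G sigma g) v
   - Gam G sigma (slap G sigma f) g v) / 2%:R.

(* On R[i], [a <= b] means equal imaginary parts and ordered real parts; for
   signatures both sides are real, so this is the order of the reals. *)
Definition CDinf (R : realType) (V : finType) (G : wgraph R V)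
    (sigma : V -> V -> R[i]) (K : R) (v : V) : Prop :=
  forall f : V -> R[i], K%:C * Gam G sigma f f v <= Gam2 G sigma f f v.

Definition is_ricci_curvature (R : realType) (V : finType) (G : wgraph R V)
    (sigma : V -> V -> R[i]) (v : V) (K : R) : Prop :=
  CDinf G sigma K v /\ forall K' : R, CDinf G sigma K' v -> K' <= K.

Definition is_Kinf (R : realType) (V : finType) (G : wgraph R V)
    (sigma : V -> V -> R[i]) (K : R) : Prop :=
  exists kappa : V -> R,
    [/\ forall v, is_ricci_curvature G sigma v (kappa v),
        exists v, kappa v = K
      & forall v, K <= kappa v].

Section Triangle.
Variable R : realType.

Definition C3_adj : rel 'I_3 := fun u v => u != v.
Definition C3_weight (_ _ : 'I_3) : R := 1.
Definition C3_measure (_ : 'I_3) : R := 2%:R.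

Fact C3_adj_sym : symmetric C3_adj.
Proof. by move=> u v; rewrite /C3_adj eq_sym. Qed.
Fact C3_adj_irr : irreflexive C3_adj.
Proof. by move=> u; rewrite /C3_adj eqxx. Qed.
Fact C3_weight_sym u v : C3_weight u v = C3_weight v u.
Proof. by []. Qed.
Fact C3_weight_gt0 u v : C3_adj u v -> 0 < C3_weight u v.
Proof. by move=> _; exact: ltr01. Qed.
Fact C3_measure_gt0 v : 0 < C3_measure v.
Proof. exact: ltr0n. Qed.

Definition C3 : wgraph R 'I_3 :=
  WGraph C3_adj_sym C3_adj_irr C3_weight_sym C3_weight_gt0 C3_measure_gt0.

(* The vertices x, y, z are 0, 1, 2. *)
Definition Sgn_C3 (sigma : 'I_3 -> 'I_3 -> R[i]) : R[i] :=
  let x : 'I_3 := inord 0 in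
  let y : 'I_3 := inord 1 in
  let z : 'I_3 := inord 2 in
  sigma x y * sigma y z * sigma z x.

End Triangle.

(* Main.v *)
Require Import Defs.
From mathcomp Require Import all_boot all_order all_algebra.
From mathcomp Require Import reals complex ring lra.
Import Order.TTheory GRing.Theory Num.Theory.
Local Open Scope ring_scope.
Local Open Scope complex_scope.

(** The curvature at [v] is found by completing squares. Read the values of [f]
    at the neighbours [a], [b] of [v] after transporting them to [v]:
    [X = sigma v a * f a - f v] and [Y = sigma v b * f b - f v]. Then
    [4 Gam = |X|^2 + |Y|^2], while, with [s] the signature of the cycle,
    [W = s Y - X] and [D = W + (s - 1) f v] (the signed difference of [f] along
    the edge [a b], also transported to [v]),

    [16 Gam2 = 2 |D|^2 + 2 Re (D W^* ) + 3 (|X|^2 + |Y|^2) + 4 Re (X Y^* )]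

    ([Gam2_C3]). The value [f v] enters only through [D], and here the two cases
    separate.

    If [s = 1], then [D = W = Y - X] is determined by [X] and [Y], and
    [Gam2 - 5/4 Gam] is [|X - Y|^2 / 8], which vanishes for [X = Y].

    If [s <> 1], then [f v] can be chosen to make [D] any number; the minimum
    over [D] is at [D = - W / 2], and leaves the Hermitian form
    [5/2 (|X|^2 + |Y|^2) + Re ((4 + s) Y X^* )], to be compared with
    [4 K (|X|^2 + |Y|^2)]. Its least eigenvalue is [(5 - |4 + s|) / 2], and
    [|4 + s|^2 = 17 + 8 Re s]. So [K = (5 - |4 + s|) / 8]; writing the
    difference [Gam2 - K Gam] as a sum of two squares
    ([curvature_form_squares]) gives both the inequality and a function
    attaining it.

    The value [s] is the same whichever vertex the cycle is started from, so the
    curvature does not depend on [v]. *)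

(** * Signed graphs *)

Lemma conj_real_complex (R : realType) (x : R) : (x%:C^*)%R = x%:C.
Proof. exact: conjc_real. Qed.

(** A function that attains the inequality bounds every competing [K'], provided
    [Gam] does not vanish on it. *)
Lemma sharp_ricci_curvature (R : realType) (V : finType) (G : wgraph R V)
    (sigma : V -> V -> R[i]) (v : V) (K : R) (f : V -> R[i]) :
  CDinf G sigma K v -> 0 < Gam G sigma f f v ->
  Gam2 G sigma f f v = K%:C * Gam G sigma f f v ->
  is_ricci_curvature G sigma v K.
Proof.
move=> CDK Gam_gt0 eqK; split=> // K' /(_ f).
by rewrite eqK ler_pM2r // lecR.
Qed.

Lemma is_Kinf_constant (R : realType) (V : finType) (G : wgraph R V)
    (sigma : V -> V -> R[i]) (K : R) (v0 : V) :
  (forall v, is_ricci_curvature G sigma v K) -> is_Kinf G sigma K.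
Proof. by move=> curvK; exists (fun=> K); split=> //; exists v0. Qed.

Lemma signature_neq0 (R : realType) (V : finType) (G : wgraph R V)
    (sigma : V -> V -> R[i]) (u v : V) :
  is_signature G sigma -> adj G u v -> sigma u v != 0.
Proof.
by move=> hsigma uv; rewrite -normr_eq0 (proj1 (hsigma u v uv)) oner_eq0.
Qed.

Lemma signature_conj (R : realType) (V : finType) (G : wgraph R V)
    (sigma : V -> V -> R[i]) (u v : V) :
  is_signature G sigma -> adj G u v -> ((sigma u v)^* = (sigma u v)^-1)%R.
Proof.
move=> hsigma uv; apply: (mulfI (signature_neq0 _ _ _ _ _ _ hsigma uv)).
rewrite mulfV ?(signature_neq0 _ _ _ _ _ _ hsigma uv) //.
by rewrite -normCK (proj1 (hsigma u v uv)) expr1n.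
Qed.

(** The signed carre du champ is a sum of products of signed differences. In the
    expansion of these products the term [f u * (g u)^*] has coefficient
    [|sigma v u|^2], which is [1], as in the unsigned Laplacian of [f * g^*]. *)
Lemma Gam_signature (R : realType) (V : finType) (G : wgraph R V)
    (sigma : V -> V -> R[i]) (f g : V -> R[i]) (v : V) :
  is_signature G sigma ->
  Gam G sigma f g v = (measure G v)^-1%:C *
    (\sum_(u | adj G v u) (weight G v u)%:C *
      ((sigma v u * f u - f v) * (sigma v u * g u - g v)^*)) / 2%:R.
Proof.
move=> hsigma; rewrite /Gam /lap /slap; congr (_ / _).
rewrite rmorphM rmorph_sum /= conj_real_complex.
rewrite (mulrCA (f v) _%:C) -(mulrA _%:C _ (g v)^*%R) -!mulrBr; congr (_ * _).
rewrite mulr_sumr mulr_suml -!sumrB; apply: eq_bigr => u vu.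
rewrite !(rmorphM, rmorphB) /= conj_real_complex.
rewrite (signature_conj _ _ _ _ _ _ hsigma vu).
by field; apply: signature_neq0 hsigma vu.
Qed.

(** * The triangle around a vertex *)

Lemma adj_C3_cycle (R : realType) (v a b : 'I_3) :
  uniq [:: v; a; b] ->
  [/\ adj (C3 R) v a, adj (C3 R) a b & adj (C3 R) b v].
Proof.
rewrite /= !inE negb_or andbT => /andP[/andP[va vb] ab].
by split=> //; rewrite /C3_adj eq_sym.
Qed.

Lemma sum_C3_neighbours (R : realType) (v a b : 'I_3) (F : 'I_3 -> R[i]) :
  uniq [:: v; a; b] -> \sum_(u | adj (C3 R) v u) F u = F a + F b.
Proof.
rewrite /= !inE andbT negb_or => /andP[/andP[va vb] ab].
rewrite (bigD1 a) //= (bigD1 b) /=; last by rewrite /C3_adj vb eq_sym.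
rewrite big_pred0 ?addr0 // => u; apply/negbTE.
apply/negP=> /andP[/andP[vu ua] ub].
have : (#|[:: v; a; b; u]| <= #|'I_3|)%N by exact: max_card.
suff /card_uniqP -> : uniq [:: v; a; b; u] by rewrite card_ord.
by rewrite /= !inE !negb_or va vb (vu : v != u) ab (eq_sym a) ua (eq_sym b) ub.
Qed.

Lemma lap_C3 (R : realType) (v a b : 'I_3) (f : 'I_3 -> R[i]) :
  uniq [:: v; a; b] ->
  lap (C3 R) f v = ((f a - f v) + (f b - f v)) / 2%:R.
Proof.
move=> vab; rewrite /lap (sum_C3_neighbours _ _ _ _ _ vab) /C3 /=.
by rewrite /C3_weight /C3_measure fmorphV rmorph_nat rmorph1 !mul1r mulrC.
Qed.

Lemma slap_C3 (R : realType) (sigma : 'I_3 -> 'I_3 -> R[i]) (v a b : 'I_3)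
    (f : 'I_3 -> R[i]) :
  uniq [:: v; a; b] ->
  slap (C3 R) sigma f v =
    ((sigma v a * f a - f v) + (sigma v b * f b - f v)) / 2%:R.
Proof.
move=> vab; rewrite /slap (sum_C3_neighbours _ _ _ _ _ vab) /C3 /=.
by rewrite /C3_weight /C3_measure fmorphV rmorph_nat rmorph1 !mul1r mulrC.
Qed.

Lemma Gam_C3 (R : realType) (sigma : 'I_3 -> 'I_3 -> R[i]) (v a b : 'I_3)
    (f g : 'I_3 -> R[i]) :
  is_signature (C3 R) sigma -> uniq [:: v; a; b] ->
  Gam (C3 R) sigma f g v =
    ((sigma v a * f a - f v) * (sigma v a * g a - g v)^* +
     (sigma v b * f b - f v) * (sigma v b * g b - g v)^*) / 4%:R.
Proof.
move=> hsigma vab.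
rewrite Gam_signature // (sum_C3_neighbours _ _ _ _ _ vab) /C3 /=.
rewrite /C3_weight /C3_measure fmorphV rmorph_nat rmorph1 !mul1r.
by field.
Qed.

(** [D] is the signed difference [sigma a b * f b - f a] multiplied by
    [sigma v a]; it differs from [W] by the holonomy defect [(s - 1) * f v]. *)
Lemma Gam2_C3 (R : realType) (sigma : 'I_3 -> 'I_3 -> R[i]) (v a b : 'I_3)
    (f : 'I_3 -> R[i]) :
  is_signature (C3 R) sigma -> uniq [:: v; a; b] ->
  let s := sigma v a * sigma a b * sigma b v in
  let X := sigma v a * f a - f v in
  let Y := sigma v b * f b - f v in
  let W := s * Y - X in
  let D := W + (s - 1) * f v in
  Gam2 (C3 R) sigma f f v =
    (2%:R * (D * D^*) + (D * W^* + W * D^*)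
     + 3%:R * (X * X^* + Y * Y^*) + 2%:R * (X * Y^* + Y * X^*)) / 16%:R.
Proof.
move=> hsigma vab s X Y W D.
have abv : uniq [:: a; b; v] by rewrite -(rot_uniq 1) in vab.
have bva : uniq [:: b; v; a] by rewrite -(rot_uniq 2) in vab.
have [va ab bv] := adj_C3_cycle R _ _ _ vab.
rewrite /Gam2 (lap_C3 _ _ _ _ _ vab) !(Gam_C3 _ _ _ _ _ _ _ hsigma vab).
rewrite !(Gam_C3 _ _ _ _ _ _ _ hsigma abv) !(Gam_C3 _ _ _ _ _ _ _ hsigma bva).
rewrite !(slap_C3 _ _ _ _ _ _ vab) !(slap_C3 _ _ _ _ _ _ abv).
rewrite !(slap_C3 _ _ _ _ _ _ bva) /D /W /X /Y /s.
have [_ ->] := hsigma _ _ va; have [_ ->] := hsigma _ _ bv.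
have [_ ->] := hsigma _ _ ab.
rewrite !(rmorphB, rmorphM, rmorphD, fmorphV, rmorph_nat, rmorph1) /=.
rewrite (signature_conj _ _ _ _ _ _ hsigma va).
rewrite (signature_conj _ _ _ _ _ _ hsigma bv).
rewrite (signature_conj _ _ _ _ _ _ hsigma ab).
by field; rewrite !(signature_neq0 _ _ _ _ _ _ hsigma) //.
Qed.

(** The value at [v] and the two signed differences at [v] are coordinates on
    the functions on the triangle, since the signature does not vanish. *)
Lemma exists_signed_differences (R : realType) (sigma : 'I_3 -> 'I_3 -> R[i])
    (v a b : 'I_3) (F X Y : R[i]) :
  is_signature (C3 R) sigma -> uniq [:: v; a; b] ->
  exists f : 'I_3 -> R[i],
    [/\ f v = F, sigma v a * f a - f v = X & sigma v b * f b - f v = Y].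
Proof.
move=> hsigma; rewrite /= !inE negb_or andbT => /andP[/andP[va vb] ab].
exists (fun u => if u == v then F else
  if u == a then (X + F) / sigma v a else (Y + F) / sigma v b).
rewrite !eqxx (eq_sym a) (eq_sym b v) (eq_sym b).
rewrite (negPf va) (negPf vb) (negPf ab).
have va0 := signature_neq0 _ _ _ _ _ _ hsigma (va : adj (C3 R) v a).
have vb0 := signature_neq0 _ _ _ _ _ _ hsigma (vb : adj (C3 R) v b).
split=> /=; first by [].
- by rewrite mulrC divfK // addrK.
- by rewrite mulrC divfK // addrK.
Qed.

(** * Curvature at a vertex *)

Lemma curvature_C3_balanced (R : realType) (sigma : 'I_3 -> 'I_3 -> R[i])
    (v a b : 'I_3) :
  is_signature (C3 R) sigma -> uniq [:: v; a; b] ->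
  sigma v a * sigma a b * sigma b v = 1 ->
  is_ricci_curvature (C3 R) sigma v (5%:R / 4%:R).
Proof.
move=> hsigma vab s1.
have deficit (f : 'I_3 -> R[i]) :
    Gam2 (C3 R) sigma f f v = (5%:R / 4%:R)%:C * Gam (C3 R) sigma f f v +
      `|(sigma v a * f a - f v) - (sigma v b * f b - f v)| ^+ 2 / 8%:R.
  have /= := Gam2_C3 _ _ _ _ _ f hsigma vab.
  rewrite s1 subrr mul0r addr0 mul1r => ->.
  rewrite (Gam_C3 _ _ _ _ _ _ _ hsigma vab) normCK rmorphM fmorphV !rmorph_nat.
  by rewrite !rmorphB /=; field.
have [f [_ fa fb]] :=
  exists_signed_differences _ _ _ _ _ 0 1 1 hsigma vab.
apply: (sharp_ricci_curvature _ _ _ _ _ _ f).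
- move=> g; rewrite deficit lerDl.
  by rewrite mulr_ge0 ?exprn_ge0 ?invr_ge0.
- rewrite (Gam_C3 _ _ _ _ _ _ _ hsigma vab) fa fb rmorph1 mulr1.
  by rewrite divr_gt0 ?addr_gt0.
- by rewrite deficit fa fb subrr normr0 expr0n mul0r addr0.
Qed.

Lemma norm_C3_cycle (R : realType) (sigma : 'I_3 -> 'I_3 -> R[i])
    (v a b : 'I_3) :
  is_signature (C3 R) sigma -> uniq [:: v; a; b] ->
  `|sigma v a * sigma a b * sigma b v| = 1.
Proof.
move=> hsigma vab; have [va ab bv] := adj_C3_cycle R _ _ _ vab.
rewrite !normrM (proj1 (hsigma _ _ va)) (proj1 (hsigma _ _ ab)).
by rewrite (proj1 (hsigma _ _ bv)) !mul1r.
Qed.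

(** The first square completes [2 |D|^2 + 2 Re (D W^* )] in [D]. Since
    [r^2 = |4 + s|^2], the second square divided by [r] is
    [r (|X|^2 + |Y|^2) + 2 Re ((4 + s) Y X^* )], twice the excess of the
    Hermitian form left over above [(5 - r) / 2 (|X|^2 + |Y|^2)]. *)
Lemma curvature_form_squares (R : realType) (s X Y D : R[i]) (r : R) :
  `|s| = 1 -> r != 0 -> r%:C ^+ 2 = `|4%:R + s| ^+ 2 ->
  let W := s * Y - X in
  (2%:R * (D * D^*) + (D * W^* + W * D^*)
   + 3%:R * (X * X^* + Y * Y^*) + 2%:R * (X * Y^* + Y * X^*)) / 16%:R =
  ((5%:R - r) / 8%:R)%:C * ((X * X^* + Y * Y^*) / 4%:R) +
    (`|2%:R * D + W| ^+ 2 + `|r%:C * X + (4%:R + s) * Y| ^+ 2 / r%:C) / 32%:R.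
Proof.
move=> norm_s r0 r2 W.
have r_neq0 : r%:C != 0 by rewrite fmorph_eq0.
have sJ : (s * s^* = 1)%R by rewrite -normCK norm_s expr1n.
have rJ : (r%:C * r%:C = (4%:R + s) * (4%:R + s^*))%R.
  by rewrite -expr2 r2 normCK rmorphD rmorph_nat.
have W2 : (W * W^* =
    X * X^* + Y * Y^* - s * (Y * X^*) - s^* * (X * Y^*))%R.
  by rewrite /W rmorphB rmorphM /=; ring: sJ.
have rXcY2 : ((r%:C * X + (4%:R + s) * Y) * (r%:C * X + (4%:R + s) * Y)^* =
    r%:C * (r%:C * (X * X^* + Y * Y^*)
            + (4%:R + s) * (Y * X^*) + (4%:R + s^*) * (X * Y^*)))%R.
  rewrite rmorphD !rmorphM rmorphD rmorph_nat /= conj_real_complex.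
  by ring: rJ.
rewrite !normCK rXcY2 mulrAC mulfV // mul1r.
rewrite rmorphM fmorphV rmorphB !rmorph_nat.
have -> : ((2%:R * D + W) * (2%:R * D + W)^* =
    4%:R * (D * D^*) + 2%:R * (D * W^* + W * D^*) + W * W^*)%R.
  by rewrite rmorphD rmorphM rmorph_nat /=; ring.
rewrite W2 {W2 rXcY2}/W rmorphB rmorphM /=.
by field.
Qed.

Lemma sqr_norm_addl4 (R : realType) (z : R[i]) :
  `|z| = 1 -> `|4%:R + z| ^+ 2 = (17%:R + 8%:R * complex.Re z)%:C.
Proof.
move=> norm_z.
have ReE : (complex.Re z)%:C = ((z + z^*) / 2%:R)%R by exact: ReJ_add.
have zJ : (z * z^* = 1)%R by rewrite -normCK norm_z expr1n.
rewrite normCK !(rmorph_nat, rmorphD, rmorphM) /= ReE.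
by field: zJ.
Qed.

Lemma curvature_C3_unbalanced (R : realType) (sigma : 'I_3 -> 'I_3 -> R[i])
    (v a b : 'I_3) :
  is_signature (C3 R) sigma -> uniq [:: v; a; b] ->
  let s := sigma v a * sigma a b * sigma b v in
  s != 1 ->
  is_ricci_curvature (C3 R) sigma v
    ((5%:R - Num.sqrt (17%:R + 8%:R * complex.Re s)) / 8%:R).
Proof.
move=> hsigma vab s s_neq1; set r := Num.sqrt _.
have norm_s : `|s| = 1 by exact: norm_C3_cycle hsigma vab.
have rad_gt0 : 0 < 17%:R + 8%:R * complex.Re s.
  have : `|complex.Re s| <= 1 by rewrite -lecR rmorph1 -norm_s normc_ge_Re.
  by rewrite ler_norml => /andP[]; lra.
have r_gt0 : 0 < r by rewrite sqrtr_gt0.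
have r_neq0 : r%:C != 0 by rewrite fmorph_eq0 gt_eqF.
have r2 : r%:C ^+ 2 = `|4%:R + s| ^+ 2.
  by rewrite -rmorphXn sqr_sqrtr ?ltW // (sqr_norm_addl4 _ _ norm_s).
have deficit (f : 'I_3 -> R[i]) :
    let X := sigma v a * f a - f v in
    let Y := sigma v b * f b - f v in
    let W := s * Y - X in
    let D := W + (s - 1) * f v in
    Gam2 (C3 R) sigma f f v = ((5%:R - r) / 8%:R)%:C * Gam (C3 R) sigma f f v +
      (`|2%:R * D + W| ^+ 2 + `|r%:C * X + (4%:R + s) * Y| ^+ 2 / r%:C) / 32%:R.
  move=> X Y W D; rewrite (Gam2_C3 _ _ _ _ _ f hsigma vab).
  rewrite (Gam_C3 _ _ _ _ _ _ _ hsigma vab).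
  exact: curvature_form_squares norm_s (lt0r_neq0 r_gt0) r2.
(* With [- (3 W) / (2 (s - 1))] as the value at [v] one has [D = - W / 2], so the
   first square vanishes; the choice of [X] and [Y] below makes the second one
   vanish. *)
have W_D_F (W : R[i]) :
    W + (s - 1) * (- (3%:R * W) / (2%:R * (s - 1))) = - W / 2%:R.
  by field; rewrite subr_eq0.
pose X := - (4%:R + s); pose Y := r%:C; pose W := s * Y - X.
have [f [fv fa fb]] := exists_signed_differences _ _ _ _ _
  (- (3%:R * W) / (2%:R * (s - 1))) X Y hsigma vab.
apply: (sharp_ricci_curvature _ _ _ _ _ _ f).
- move=> g; rewrite deficit lerDl.
  rewrite mulr_ge0 ?invr_ge0 // addr_ge0 ?exprn_ge0 // divr_ge0 ?exprn_ge0 //.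
  by rewrite lecR ltW.
- rewrite (Gam_C3 _ _ _ _ _ _ _ hsigma vab) fa fb -!normCK divr_gt0 //.
  by rewrite ltr_wpDl ?exprn_ge0 // exprn_gt0 // normr_gt0.
- rewrite deficit fa fb fv -/W W_D_F.
  have -> : 2%:R * (- W / 2%:R) + W = 0 by field.
  have -> : r%:C * X + (4%:R + s) * Y = 0 by rewrite /X /Y; ring.
  by rewrite !normr0 !expr0n /= mul0r addr0 mul0r addr0.
Qed.

Theorem proposition3p14 (R : realType) (sigma : 'I_3 -> 'I_3 -> R[i])
    (hsigma : is_signature (C3 R) sigma) :
  let s := Sgn_C3 sigma in
  let K := if s == 1 then 5%:R / 4%:R
           else (5%:R - Num.sqrt (17%:R + 8%:R * complex.Re s)) / 8%:R in
  (forall v : 'I_3, is_ricci_curvature (C3 R) sigma v K) /\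
  is_Kinf (C3 R) sigma K.
Proof.
move=> s K.
suff curvK v : is_ricci_curvature (C3 R) sigma v K.
  by split=> //; apply: (is_Kinf_constant _ _ _ _ _ ord0).
(* The cycle is read from [v] in the orientation x, y, z, so its signature is a
   cyclic rotation of the product defining [s]. *)
have [a [b [vab sE]]] : exists a b, uniq [:: v; a; b] /\
    s = sigma v a * sigma a b * sigma b v.
  pose x : 'I_3 := inord 0; pose y : 'I_3 := inord 1; pose z : 'I_3 := inord 2.
  have [->|->|->] : [\/ v = x, v = y | v = z].
    by case: v => [[|[|[|//]]] ?]; [apply: Or31|apply: Or32|apply: Or33];
      apply: val_inj; rewrite /= inordK.
  - exists y, z; split=> //; by rewrite /= !inE -!val_eqE /= !inordK.
  - exists z, x; split; first by rewrite /= !inE -!val_eqE /= !inordK.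
    by rewrite /s /Sgn_C3 -/x -/y -/z [RHS]mulrC mulrA.
  - exists x, y; split; first by rewrite /= !inE -!val_eqE /= !inordK.
    by rewrite /s /Sgn_C3 -/x -/y -/z [LHS]mulrC mulrA.
rewrite /K; case: eqP => [s1|/eqP s_neq1].
  by apply: (curvature_C3_balanced _ _ _ _ _ hsigma vab); rewrite -sE.
by rewrite sE in s_neq1 *; apply: curvature_C3_unbalanced.
Qed.
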